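(* Consider the following conditions. (A) $Q(\cdot|x)$ is weakly continuous in $x$ and $\mathcal{T}(\cdot|x,u)$ is weakly continuous in $(x,u)$. (B) The stochastic kernel $\kappa(dx|s)=P(X_t\in dx\,|\,S_t=s)$ is weakly continuous: for every continuous bounded $f:\mathbb{X}\to\mathbb{R}$, $\int f(x)\kappa(dx|s)$ is continuous in $s$ (product topology). (C) The filter $\pi_t$ is $\sigma(S_t)$-measurable; in particular, independently of the control policy, there exists a measurable $g$ with $g(S_t)(A)=\pi_t(A)$ for every Borel $A\subset\mathbb{X}$. Then: (i) Under (C), for all $u\in\mathbb{U}$, $E[c(X_k,u)\,|\,S_k=s]=\bar c(s,u)$ for some measurable $\bar c:\mathbb{Y}^{\mathbb{Z}_-}\times\mathbb{U}^{\mathbb{Z}_-}\times\mathbb{U}\to\mathbb{R}$. (ii) Under (B), $\bar c$ is continuous and bounded (recall that $c$ is bounded and continuous). (iii) Under (A) and (B), the kernel $\mathbb{P}^d(S_{t+1}\in\cdot\,|\,S_t=s,U_t=u)$ is weak Feller, i.e. $\int f(s')\,\mathbb{P}^d(ds'|s,u)$ is continuous in $(s,u)$ for every continuous bounded $f$.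
   Context: Model: $\mathbb{X}$, $\mathbb{Y}$ are standard Borel (Polish) spaces and $\mathbb{U}$ is a compact metric action space. $X_{t+1}=F(X_t,U_t,W_t)$, $Y_t=G(X_t,V_t)$ with mutually independent i.i.d. noise sequences; $\mathcal{T}(B|x,u)=P(X_1\in B|X_0=x,U_0=u)$, $Q(C|x)=P(Y_0\in C|X_0=x)$. The stage cost $c:\mathbb{X}\times\mathbb{U}\to\mathbb{R}_+$ is bounded and continuous. Infinite past: measurements and actions are assumed to have been taking place since $-\infty$. $\mathbb{Y}^{\mathbb{Z}_-}$ and $\mathbb{U}^{\mathbb{Z}_-}$ are one-sided products over $\{\dots,-2,-1,0\}$ with the product topology; a sequence $u_{(-\infty,-1]}$ is viewed as an element of $\mathbb{U}^{\mathbb{Z}_-}$. Put $S_t=(Y_{(-\infty,t]},U_{(-\infty,t-1]})$, taking values in $\mathbb{Y}^{\mathbb{Z}_-}\times\mathbb{U}^{\mathbb{Z}_-}$. Controls are functions of $S_t$. $\kappa(dx|s)$ denotes the stochastic kernel $P(X_t\in dx|S_t=s)$. The filter $\pi_t$ is the conditional distribution of $X_t$ given the information and distant priors: for every $n$, $\pi_t(A)=E[1_{\{X_t\in A\}}\,|\,\sigma(S_t)\vee\sigma(\pi_{(-\infty,-n]})]$ (beliefs $\pi_m$, $m\le -n$). The kernel $\mathbb{P}^d(\cdot|s,u)$ is the transition kernel of $S_t$: given $S_t=s=(y_{(-\infty,t]},u_{(-\infty,t-1]})$ and $U_t=u$, $S_{t+1}$ appends $u$ to the action history and $Y_{t+1}$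 to the measurement history, where $Y_{t+1}\sim\int\kappa(dx|s)\int\mathcal{T}(dx'|x,u)\,Q(\cdot|x')$. *)

(* Defs.v *)
From HB Require Import structures.
From mathcomp Require Import all_boot all_order all_algebra.
From mathcomp Require Import all_classical all_reals all_analysis.
From mathcomp Require Import measurable_realfun.

Set Implicit Arguments.
Unset Strict Implicit.
Unset Printing Implicit Defensive.
Import Order.TTheory GRing.Theory Num.Theory.
Import numFieldNormedType.Exports.

Local Open Scope classical_set_scope.
Local Open Scope ring_scope.

#[short(type="pmetricType")]
HB.structure Definition PointedMetric (R : numDomainType) :=
  {T of Metric R T & Pointed T}.

#[short(type="completeMetricType")]
HB.structure Definition CompleteMetric (R : numDomainType) :=
  {T of Metric R T & Complete T}.

Definition separable (T : topologicalType) : Prop :=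
  exists2 D : set T, countable D & dense D.

HB.instance Definition _ (I : Type) (T : I -> ptopologicalType) :=
  Pointed.copy (prod_topology T) (forall i, T i).

HB.instance Definition _ (S T : ptopologicalType) :=
  Pointed.copy (S * T)%type (S * T)%type.

(* The carrier of T, up to conversion, with the Borel sigma-algebra of T; the
   topology is not inherited, so continuity is always stated on T itself. *)
Notation borel T := (g_sigma_algebraType (@open T)).

(* Values of S_t = (Y_(-oo,t], U_(-oo,t-1]). A sequence indexed by
   {..., -2, -1, 0} is encoded on nat, the index n standing for -n: entry 0 is
   the most recent one, i.e. Y_t in the first component and U_(t-1) in the
   second. *)
Notation hist Y U := ({ptws nat -> Y} * {ptws nat -> U})%type.

Definition hist_cons (Y U : Type) (y : Y) (u : U) (s : hist Y U) : hist Y U :=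
  ((fun n => if n is m.+1 then s.1 m else y),
   (fun n => if n is m.+1 then s.2 m else u)).

Lemma continuous_hist_cons (Y U : topologicalType) (u : U) (s : hist Y U) :
  continuous (fun y : Y => hist_cons y u s).
Proof.
move=> y; apply: (@cvg_pair _ _ _ _ (nbhs _) (nbhs _)).
  apply/cvg_sup => n A [_ [[B oB <-] /= By] sBA].
  suff : nbhs y [set z | B ((hist_cons z u s).1 n)].
    by apply: filterS => z Bz; exact: sBA.
  case: n By {sBA} => [|n] /= By; last exact: nearW.
  exact: open_nbhs_nbhs.
exact: cvg_cst.
Qed.

Lemma measurable_hist_cons (Y U : ptopologicalType) (u : U) (s : hist Y U) :
  measurable_fun [set: borel Y]
    (fun y : borel Y => hist_cons y u s : borel (hist Y U)).
Proof.
by apply: (@measurability _ _ (borel Y) (borel (hist Y U)) _ _ (@open (hist Y U))) => // _ [B oB <-];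
  rewrite setTI; apply: sub_sigma_algebra; apply: open_comp => // z _;
  exact: continuous_hist_cons.
Qed.

Section weak_continuity.
Context (R : realType) (D : topologicalType) (T : ptopologicalType).

Definition weakly_continuous (k : D -> {measure set (borel T) -> \bar R}) :
  Prop :=
  forall f : T -> R, continuous f -> bounded_fun f ->
    continuous (fun x : D => \int[k x]_y f y).

End weak_continuity.

Section sigma_algebras.
Context (Om : Type).

Definition sigma_of d (T : measurableType d) (f : Om -> T) : set (set Om) :=
  preimage_set_system [set: Om] f measurable.

Definition measurable_wrt d (T : measurableType d) (H : set (set Om))
    (f : Om -> T) : Prop := sigma_of f `<=` H.

End sigma_algebras.

Section conditioning.
Context (R : realType) d (Om : measurableType d) (P : probability Om R).

Definition mutually_independent (I : eqType) (H : I -> set (set Om)) : Prop :=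
  forall (J : seq I) (A : I -> set Om), uniq J ->
    (forall i, i \in J -> H i (A i)) ->
    P (\bigcap_(i in [set` J]) A i) = (\prod_(i <- J) P (A i))%E.

Definition independent (H1 H2 : set (set Om)) : Prop :=
  forall A B, H1 A -> H2 B -> P (A `&` B) = (P A * P B)%E.

Definition ae_measurable_wrt (H : set (set Om)) (f : Om -> R) : Prop :=
  exists2 g : Om -> R, measurable_wrt H g & {ae P, forall w, f w = g w}.

(* E is a version of E[Z | H]; E itself only has to be H-measurable up to a
   P-null set. *)
Definition is_cond_exp (H : set (set Om)) (Z E : Om -> R) : Prop :=
  P.-integrable [set: Om] (EFin \o Z) /\
  exists E' : Om -> R,
    [/\ measurable_wrt H E',
        P.-integrable [set: Om] (EFin \o E'),
        forall A, H A -> (\int[P]_(w in A) (E' w)%:E =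
                          \int[P]_(w in A) (Z w)%:E)%E &
        {ae P, forall w, E w = E' w}].

End conditioning.

Record process (R : realType) d (Om : measurableType d) (X Y U W V : Type) :=
  Process {
    law : probability Om R;
    stX : int -> Om -> X;
    obY : int -> Om -> Y;
    acU : int -> Om -> U;
    noW : int -> Om -> W;
    noV : int -> Om -> V
  }.

Section model.
Context (R : realType) (X Y : completeMetricType R) (U : pmetricType R).
Context (dO dW dV : measure_display) (Om : measurableType dO)
  (W : measurableType dW) (V : measurableType dV).

Definition policy := int -> hist Y U -> U.

Implicit Types (p : process R Om X Y U W V) (gam : policy).

Definition histS p (t : int) (w : Om) : hist Y U :=
  ((fun n : nat => obY p (t - n%:Z) w),
   (fun n : nat => acU p (t - 1 - n%:Z) w)).

Definition sigmaX p t := sigma_of (stX p t : Om -> borel X).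
Definition sigmaY p t := sigma_of (obY p t : Om -> borel Y).
Definition sigmaU p t := sigma_of (acU p t : Om -> borel U).
Definition sigmaW p t := sigma_of (noW p t).
Definition sigmaV p t := sigma_of (noV p t).
Definition sigmaS p t := sigma_of (histS p t : Om -> borel (hist Y U)).

Definition past p (t : int) : set (set Om) :=
  <<s (\bigcup_(r in [set r | r <= t]) sigmaX p r) `|`
      (\bigcup_(r in [set r | r < t])
         (sigmaY p r `|` sigmaU p r `|` sigmaW p r `|` sigmaV p r)) >>.

Definition future_noise p (t : int) : set (set Om) :=
  <<s \bigcup_(r in [set r | t <= r]) (sigmaW p r `|` sigmaV p r) >>.

Definition noise_sigma p (i : int + int) : set (set Om) :=
  match i with inl t => sigmaW p t | inr t => sigmaV p t end.

(* Without an initial time, the assumption that X_t depends on the noise only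
   through its values before t has to be stated (the last clause); it is what
   makes the law of F (x, u, .) under muW the transition kernel of p. *)
Definition controlled (F : X * U * W -> X) (G : X * V -> Y)
    (muW : probability W R) (muV : probability V R) gam p : Prop :=
  [/\ [/\ forall t, measurable_fun [set: Om] (stX p t : Om -> borel X),
          forall t, measurable_fun [set: Om] (obY p t : Om -> borel Y),
          forall t, measurable_fun [set: Om] (acU p t : Om -> borel U),
          forall t, measurable_fun [set: Om] (noW p t) &
          forall t, measurable_fun [set: Om] (noV p t)],
      [/\ forall t, measurable_fun [set: borel (hist Y U)]
            (gam t : borel (hist Y U) -> borel U),
          forall t w, stX p (t + 1) w = F (stX p t w, acU p t w, noW p t w),
          forall t w, obY p t w = G (stX p t w, noV p t w) &
          forall t w, acU p t w = gam t (histS p t w)],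
      [/\ forall t B, measurable B -> law p (noW p t @^-1` B) = muW B,
          forall t B, measurable B -> law p (noV p t @^-1` B) = muV B &
          mutually_independent (law p) (noise_sigma p)] &
      forall t, independent (law p) (past p t) (future_noise p t)].

Definition is_filter p (pi : int -> Om -> pprobability (borel X) R) : Prop :=
  (forall t, measurable_fun [set: Om] (pi t)) /\
  (* for t < 0 only the n with -n <= t are considered, so that the beliefs
     conditioned upon are never posterior to t *)
  forall (t : int) (n : nat) (A : set (borel X)),
    - n%:Z <= t -> measurable A ->
    is_cond_exp (law p)
      <<s sigmaS p t `|` \bigcup_(m in [set m : int | m <= - n%:Z])
            sigma_of (pi m) >>
      (\1_(stX p t @^-1` A)) (fun w => fine (pi t w A)).

Definition is_state_kernel p
    (kappa : R.-pker (borel (hist Y U)) ~> (borel X)) : Prop :=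
  forall (t : int) (A : set (borel X)), measurable A ->
    is_cond_exp (law p) (sigmaS p t)
      (\1_(stX p t @^-1` A)) (fun w => fine (kappa (histS p t w) A)).

Definition is_expected_cost (c : X * U -> R) p (cbar : hist Y U * U -> R) :
  Prop :=
  forall (u : U) (k : int),
    is_cond_exp (law p) (sigmaS p k)
      (fun w => c (stX p k w, u)) (fun w => cbar (histS p k w, u)).

Definition expected_cost (c : X * U -> R)
    (kappa : R.-pker (borel (hist Y U)) ~> (borel X)) (su : hist Y U * U) : R :=
  \int[kappa su.1]_x c (x, su.2).

(* sys i is the process under the i-th admissible policy; the index set is
   arbitrary, and g depends neither on the policy nor on time. *)
Definition filter_measurable (I : Type) (sys : I -> process R Om X Y U W V)
    (pi : I -> int -> Om -> pprobability (borel X) R) : Prop :=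
  (forall i t (A : set (borel X)), measurable A ->
     ae_measurable_wrt (law (sys i)) (sigmaS (sys i) t)
       (fun w => fine (pi i t w A))) /\
  exists2 g : borel (hist Y U) -> pprobability (borel X) R,
    measurable_fun [set: borel (hist Y U)] g &
    forall i t (A : set (borel X)), measurable A ->
      {ae law (sys i), forall w, g (histS (sys i) t w) A = pi i t w A}.

End model.

Section kernel_precomposition.
Context (R : realType) d1 d2 d3 (A : measurableType d1)
  (B : measurableType d2) (C : measurableType d3).
Context (k : R.-ker B ~> C) (f : A -> B) (mf : measurable_fun [set: A] f).

Definition kpre of measurable_fun [set: A] f : A -> {measure set C -> \bar R} :=
  fun x => k (f x).

Let measurable_kpre (D : set C) :
  measurable D -> measurable_fun [set: A] (fun x => kpre mf x D).
Proof.
by move=> mD; exact: measurableT_comp (measurable_kernel k D mD) mf.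
Qed.

HB.instance Definition _ := isKernel.Build d1 d3 A C R (kpre mf) measurable_kpre.

End kernel_precomposition.

Section history_kernel.
Context (R : realType) (X Y : completeMetricType R) (U : pmetricType R).
Context (T : R.-pker (borel X * borel U)%type ~> (borel X))
  (Q : R.-pker (borel X) ~> (borel Y))
  (kappa : R.-pker (borel (hist Y U)) ~> (borel X)).

Let S := borel (hist Y U).

Let state_action (q : (S * borel U) * borel X) : borel X * borel U :=
  (q.2, q.1.2).

Let measurable_state_action : measurable_fun setT state_action.
Proof.
apply/measurable_fun_pairP; split; first exact: measurable_snd.
exact: measurableT_comp measurable_snd measurable_fst.
Qed.

(* the law of Y_(t+1) given (S_t, U_t) = (s, u) *)
Definition next_obs : S * borel U -> {measure set (borel Y) -> \bar R} :=
  mkcomp (kpre kappa (@measurable_fst _ _ S (borel U)))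
         (kpre (mkcomp_noparam T Q) measurable_state_action).

Definition hist_kernel (su : hist Y U * U) :
    {measure set (borel (hist Y U)) -> \bar R} :=
  measure_function_pushforward__canonical__measure_function_Measure
    (next_obs su) (measurable_hist_cons su.2 su.1).

Lemma hist_kernelE (s : hist Y U) (u : U) (B : set (borel (hist Y U))) :
  hist_kernel (s, u) B =
  (\int[kappa s]_x \int[T (x, u)]_x' Q x' [set y | B (hist_cons y u s)])%E.
Proof. by []. Qed.

End history_kernel.

(* Main.v *)
(* The point behind (ii) and (iii) is that (s, e) |-> \int f(x, e) k_s(dx) is
   continuous whenever k is weakly continuous and f is bounded and continuous.
   No tightness is needed: around each x there is a ball on which f(x, e) is
   close to f(x, e0) for all e near e0; by separability countably many such
   balls cover the space, so a continuous function H with values in [0, 1],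
   supported by finitely many of them, has k_(s0)-integral at least 1 - eps.
   Weak continuity keeps the integral of H above 1 - eps for s near s0, and
   |f(x, e) - f(x, e0)| <= eps + 2 M (1 - H x) for every x.
   Applied to kappa and c this gives (ii); as P^d is the iterated integral
   over kappa, T and Q, applying it to Q, then T, then kappa gives (iii).
   For (i), g is a stochastic kernel which is a version of P(X_t \in . | S_t):
   for H in sigma(S_t), the law of X_t under the restriction of P to H is the
   mixture over w in H of the kernel at S_t(w), and integrating c(., u)
   against both gives the conditional expectation. *)
Require Import Defs.
From HB Require Import structures.
From mathcomp Require Import all_boot all_order all_algebra.
From mathcomp Require Import all_classical all_reals all_analysis.
From mathcomp Require Import measurable_realfun.
From mathcomp Require Import lra zify.

Set Implicit Arguments.
Unset Strict Implicit.
Unset Printing Implicit Defensive.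
Import Order.TTheory GRing.Theory Num.Theory.
Import numFieldNormedType.Exports.

Local Open Scope classical_set_scope.
Local Open Scope ring_scope.

(** * Continuity into products and of the distance *)

Section continuity.

Lemma continuousT_comp (A B C : topologicalType) (f : A -> B) (g : B -> C) :
  continuous f -> continuous g -> continuous (fun x => g (f x)).
Proof. by move=> cf cg x; apply: continuous_comp; [exact: cf|exact: cg]. Qed.

Lemma continuousT_pair (A B C : topologicalType) (f : A -> B) (g : A -> C) :
  continuous f -> continuous g -> continuous (fun x => (f x, g x)).
Proof. by move=> cf cg x; apply: cvg_pair; [exact: cf|exact: cg]. Qed.

Lemma continuous_sectionl (A B C : topologicalType) (f : A * B -> C) (b : B) :
  continuous f -> continuous (fun a => f (a, b)).
Proof.
by apply: continuousT_comp; apply: continuousT_pair => a;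
  [exact: cvg_id|exact: cvg_cst].
Qed.

Lemma continuous_ptws (I : eqType) (Z Y : topologicalType) (f : Z -> I -> Y) :
  (forall i, continuous (fun z => f z i)) ->
  continuous (f : Z -> {ptws I -> Y}).
Proof.
move=> cf z; apply/cvg_sup => i A [_ [[B oB <-] /= Bz] BA].
suff : nbhs z [set z' | B (f z' i)] by apply: filterS => z' Bz'; exact: BA.
exact: (cf i z B (open_nbhs_nbhs (conj oB Bz))).
Qed.

Lemma continuous_ptws_proj (I : eqType) (Y : topologicalType) (i : I) :
  continuous (fun f : {ptws I -> Y} => f i).
Proof. exact: (@proj_continuous I (fun=> Y) i). Qed.

End continuity.

Section metric.
Context (R : realType) (T : metricType R).

Lemma mdist_continuous (y : T) : continuous (mdist y : T -> R).
Proof.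
move=> x; apply/cvgrPdist_lt => e e0.
apply/nbhs_ballP; exists e => //= z; rewrite ballEmdist/= => xz.
have := metric_triangle y x z; have := metric_triangle y z x.
by rewrite (metric_sym z x) ltr_norml; lra.
Qed.

End metric.

(** * Countable bases of separable metric spaces and of sequence spaces *)

Section countable_base.

(** Indexing by a type lets countability be carried by the index: [nat] for a factor, finite lists
    of pairs for a space of sequences. *)
Definition base_family (T : topologicalType) (J : Type) (b : J -> set T) :=
  (forall j, open (b j)) /\
  forall x A, nbhs x A -> exists2 j, b j x & b j `<=` A.

Lemma second_countable_base (T : topologicalType) : @second_countable T ->
  exists b : nat -> set T, base_family b.
Proof.
move=> [B /countable_injP[f injf] [Bo Bb]].
(* The injection [f] is inverted; numbers that code no base set give [set0], which is open and so
   harmless. *)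
exists (fun n => xget set0 [set A | B A /\ f A = n]); split=> [n|x A xA].
  by case: xgetP => [A _ [/Bo]|_]//; exact: open0.
have [C [BC Cx] CA] := Bb x A xA.
suff bC : xget set0 [set A | B A /\ f A = f C] = C by exists (f C); rewrite bC.
case: xgetP => [D _ [BD fD]|/(_ C)]; last by move=> /not_andP[].
by apply: injf; rewrite ?inE.
Qed.

(** Tents of height and radius [1/(N+1)] around dense points. The base comes as positivity sets of
    continuous functions because the functions themselves are later summed into a cutoff. *)
Lemma separable_bump_base (R : realType) (T : pmetricType R) : separable T ->
  exists h : nat -> T -> R, [/\ forall n, continuous (h n),
    forall n x, 0 <= h n x & base_family (fun n => [set x | 0 < h n x])].
Proof.
move=> [D /countable_injP[f injf] dD].
pose d n := xget point [set x : T | D x /\ f x = n].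
have dE x : D x -> d (f x) = x.
  move=> Dx; rewrite /d; case: xgetP => [y _ [Dy fyx]|/(_ x)].
    by apply: injf; rewrite ?inE.
  by move=> /not_andP[].
(* [n] codes a pair: the number of a dense point and the [N] of its radius. *)
pose h n x : R := if unpickle n is Some p then
  Num.max 0 (p.2.+1%:R^-1 - mdist (d p.1) x) else 0.
have ch n : continuous (h n).
  rewrite /h; case: unpickle => [p|] x; last exact: cvg_cst.
  have c0 : {for x, continuous (fun=> 0 : R^o)} by exact: cvg_cst.
  apply: (continuous_max c0).
  by apply: cvgB; [exact: cvg_cst|exact: mdist_continuous].
exists h; split=> //.
- by move=> n x; rewrite /h; case: unpickle => [p|]//; rewrite le_max lexx.
split=> [n|x A /nbhs_ballP[_/posnumP[e] eA]].
  apply: (@open_comp _ _ (h n) [set y : R | 0 < y]) => [y _|]; first exact: ch.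
  exact: open_gt.
(* Half of [e]: the tent is centred at a dense point [y] near [x], and passing from [x] to [z]
   through [y] costs two radii. *)
have [//|N] := @ltr_add_invr R 0 (e%:num / 2); rewrite add0r => Ne.
have N0 : 0 < N.+1%:R^-1 :> R by rewrite invr_gt0.
have [y [xy Dy]] : (ball x N.+1%:R^-1 : set T)° `&` D !=set0.
  apply: dD; last exact: open_interior.
  by exists x; exact: (nbhsx_ballx x _ N0).
move/interior_subset/ball_sym : xy => xy.
have hE z : (0 < h (pickle (f y, N)) z) = (mdist y z < N.+1%:R^-1).
  by rewrite /h pickleK/= dE// lt_max ltxx subr_gt0.
exists (pickle (f y, N)) => [/=|z /=]; rewrite hE.
  by move: xy; rewrite ballEmdist.
move=> yz; apply: eA; rewrite [e%:num]splitr.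
apply: (@ball_triangle _ _ y).
  by apply: (le_ball (ltW Ne)); exact: ball_sym.
by apply: (le_ball (ltW Ne)); rewrite ballEmdist.
Qed.

(** A list of constraints is again countably indexed when [I] and [J] are, and concatenating lists
    intersects cylinders. *)
Definition cylinder (I J : eqType) (Y : Type) (b : J -> set Y)
    (L : seq (I * J)) : set (I -> Y) :=
  [set y | forall p, p \in L -> b p.2 (y p.1)].

Lemma ptws_base (I : countType) (J : countType) (Y : topologicalType)
    (b : J -> set Y) : base_family b ->
  base_family (cylinder b : seq (I * J) -> set {ptws I -> Y}).
Proof.
move=> [bo bb]; split=> [L|y A yA].
  elim: L => [|p L IHL].
    rewrite (_ : cylinder _ _ = setT); first exact: openT.
    by apply/seteqP; split=> // y _ p; rewrite in_nil.
  rewrite (_ : cylinder _ _ = (proj p.1 @^-1` b p.2) `&` cylinder b L).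
    by apply: openI => //; apply: open_comp => // y _; exact: proj_continuous.
  apply/seteqP; split=> [y yL|y [yp yL] q]; last first.
    by rewrite inE => /orP[/eqP ->|/yL].
  by split=> [|q qL]; apply: yL; rewrite inE ?eqxx// qL orbT.
(* The cylinders through [y] generate a filter. Its convergence to [y] is what is wanted, and can be
   tested one coordinate at a time, with lists of length one. *)
pose F := filter_from [set L : seq (I * J) | cylinder b L y] (cylinder b).
have FF : Filter F.
  apply: filter_from_filter; first by exists [::] => p; rewrite in_nil.
  move=> L M Ly My; exists (L ++ M).
    by move=> p; rewrite mem_cat => /orP[/Ly|/My].
  by move=> z Lz; split=> p pL; apply: Lz; rewrite mem_cat pL ?orbT.
suff /(_ A yA)[L Ly LA] : F --> (y : {ptws I -> Y}) by exists L.
apply/cvg_sup => i B [_ [[C oC <-] /= Cy] CB].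
have [j bj jC] := bb (y i) C (open_nbhs_nbhs (conj oC Cy)).
exists [:: (i, j)]; first by move=> p; rewrite inE => /eqP ->.
by move=> z /(_ (i, j)); rewrite inE eqxx => /(_ isT)/jC Cz; exact: CB.
Qed.

End countable_base.

(** * Borel sigma-algebras of products against products of Borel sigma-algebras *)

Section borel.

Lemma continuous_real_measurable (R : realType) (S : ptopologicalType)
    (f : S -> R) :
  continuous f -> measurable_fun [set: borel S] (f : borel S -> R).
Proof.
move=> cf; apply: (measurability _ (RGenOpens.measurableE R)).
move=> _ [_ [x [y ->]] <-].
rewrite setTI; apply: sub_sigma_algebra.
by apply: open_comp; [move=> ? _; exact: cf|exact: interval_open].
Qed.

(** Every open set is a countable union of base sets. *)
Lemma base_measurable_fun d (Om : measurableType d) (T : ptopologicalType)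
    (J : countType) (b : J -> set T) (f : Om -> T) :
  base_family b -> (forall j, measurable (f @^-1` b j)) ->
  measurable_fun [set: Om] (f : Om -> borel T).
Proof.
move=> [_ bb] mf.
apply: (@measurability _ _ Om (borel T) _ _ (@open T)) => // _ [B oB <-].
rewrite setTI (_ : B = \bigcup_(j in [set j | b j `<=` B]) b j); last first.
  apply/seteqP; split=> [x Bx|x [j jB /jB]//].
  by have [j jx jB] := bb x B (open_nbhs_nbhs (conj oB Bx)); exists j.
rewrite preimage_bigcup bigcup_mkcond.
by apply: countable_bigcupT_measurable => // j; case: ifPn.
Qed.

(** [O] is the countable union of the rectangles [b j] times [V j], where [V j] is the largest open
    set for which the rectangle stays in [O]. *)
Lemma open_prod_measurable (S T : ptopologicalType) (J : countType)
    (b : J -> set S) (O : set (S * T)) : base_family b -> open O ->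
  measurable (O : set (borel S * borel T)).
Proof.
move=> [bo bb] oO.
pose V j : set T := \bigcup_(A in [set A : set T | open A /\ b j `*` A `<=` O]) A.
rewrite (_ : O = \bigcup_j (b j `*` V j)); last first.
  apply/seteqP; split=> [[x y] Oxy|[x y] [j _ [/= bx [A [_ AO] Ay]]]]; last first.
    exact: AO.
  have [[A B] [/= xA yB] ABO] : nbhs (x, y) O by exact: open_nbhs_nbhs.
  have [j bx bA] := bb x A xA; exists j => //; split=> //=.
  exists B°; last by exact: yB.
  split; first exact: open_interior.
  by move=> [z1 z2] [/= /bA Az /interior_subset Bz]; exact: ABO.
apply: countable_bigcupT_measurable => // j; apply: measurableX; apply: sub_sigma_algebra => //.
by apply: bigcup_open => A [].
Qed.

Lemma continuous_prod_measurable (R : realType) (S T : ptopologicalType)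
    (J : countType) (b : J -> set S) (f : S * T -> R) : base_family b ->
  continuous f -> measurable_fun [set: borel S * borel T] (f : borel S * borel T -> R).
Proof.
move=> hb cf; apply: (measurability _ (RGenOpens.measurableE R)).
move=> _ [_ [x [y ->]] <-].
rewrite setTI; apply: (open_prod_measurable hb).
by apply: open_comp; [move=> ? _; exact: cf|exact: interval_open].
Qed.

Lemma measurable_pair_borel d (Om : measurableType d) (S T : ptopologicalType)
    (J : countType) (b : J -> set S) (f : Om -> S) (g : Om -> T) : base_family b ->
  measurable_fun [set: Om] (f : Om -> borel S) ->
  measurable_fun [set: Om] (g : Om -> borel T) ->
  measurable_fun [set: Om] ((fun w => (f w, g w)) : Om -> borel (S * T)%type).
Proof.
move=> hb mf mg.
apply: (@measurability _ _ Om (borel (S * T)%type) _ _ (@open (S * T)%type)) => //.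
move=> _ [B oB <-].
exact: (measurable_fun_pair mf mg measurableT (open_prod_measurable hb oB)).
Qed.

Lemma measurable_ptws_borel d (Om : measurableType d) (Y : ptopologicalType)
    (I J : countType) (b : J -> set Y) (f : Om -> I -> Y) : base_family b ->
  (forall i, measurable_fun [set: Om] ((fun w => f w i) : Om -> borel Y)) ->
  measurable_fun [set: Om] (f : Om -> borel {ptws I -> Y}).
Proof.
move=> hb mf; apply: (base_measurable_fun (ptws_base I hb)) => L.
rewrite (_ : _ @^-1` _ =
    \bigcap_(p in [set` L]) ((fun w => f w p.1) @^-1` b p.2)); last first.
  by apply/seteqP; split=> y yL p /yL.
apply: fin_bigcap_measurable => // p _; rewrite -[X in measurable X]setTI.
by apply: mf => //; apply: sub_sigma_algebra; exact: hb.1.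
Qed.

End borel.

(** * Bounded functions and their integrals under a measure of mass one *)

Lemma bounded_funW (R : realType) (T : Type) (f : T -> R) (M : R) :
  (forall x, `|f x| <= M) -> bounded_fun f.
Proof.
by move=> fM; exists M; split=> [|N /ltW MN x _];
  [exact: num_real|exact: le_trans (fM x) MN].
Qed.

Section bounded_integral.
Context (R : realType) (d : measure_display) (T : measurableType d).
Context (mu : {measure set T -> \bar R}) (mu1 : mu [set: T] = 1%E).

Lemma bounded_integrable (f : T -> R) (M : R) :
  measurable_fun [set: T] f -> (forall x, `|f x| <= M) ->
  mu.-integrable [set: T] (EFin \o f).
Proof.
move=> mf fM; apply: measurable_bounded_integrable => //; first by rewrite mu1 ltry.
exact: bounded_funW fM.
Qed.

Lemma Rintegral_cst1 (r : R) : \int[mu]_x r = r.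
Proof. by rewrite Rintegral_cst// mu1 mulr1. Qed.

Lemma Rintegral_bound (f : T -> R) (M : R) : measurable_fun [set: T] f ->
  (forall x, `|f x| <= M) -> `|\int[mu]_x f x| <= M.
Proof.
move=> mf fM; have intf := bounded_integrable mf fM.
apply: (le_trans (le_normr_Rintegral measurableT intf)).
rewrite -[leRHS]Rintegral_cst1; apply: le_Rintegral => //.
- apply: (@bounded_integrable _ M); first exact: measurableT_comp.
  by move=> x; rewrite normr_id.
- by apply: (@bounded_integrable _ `|M|).
Qed.

End bounded_integral.

(** * Joint continuity of parametrised integrals *)

Section joint_continuity.
Context (R : realType) (S E : topologicalType) (X : pmetricType R).
Context (k : S -> {measure set (borel X) -> \bar R}).
Context (k1 : forall s, k s [set: X] = 1%E).
Context (sepX : separable X) (wk : weakly_continuous k).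

Theorem weakly_continuous_joint (f : X * E -> R) (M : R) :
  continuous f -> (forall p, `|f p| <= M) ->
  continuous (fun se : S * E => \int[k se.1]_x f (x, se.2)).
Proof.
move=> cf fM [s0 e0]; have [h [ch h0 [_ hb]]] := separable_bump_base sepX.
have M0 : 0 <= M by apply: le_trans (fM (point, e0)).
have cfe e : continuous (fun x => f (x, e)).
  exact: continuous_sectionl.
have mfe e := continuous_real_measurable (cfe e).
have ife s e : (k s).-integrable [set: borel X] (EFin \o (fun x => f (x, e))).
  exact: (bounded_integrable (k1 s) (mfe e) (fun x => fM _)).
have mdf e : measurable_fun [set: borel X] (fun x => f (x, e0) - f (x, e)).
  exact: measurable_funB.
have df2 e x : `|f (x, e0) - f (x, e)| <= 2 * M.
  by have := fM (x, e0); have := fM (x, e); rewrite !ler_norml; lra.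
apply/cvgrPdist_le => _/posnumP[eps] /=.
(* Moving [s] costs [c] and moving [e] costs [c + 2 * M * c]; the total [(2 * M + 2) * c] is below
   [eps]. *)
pose c := eps%:num / (2 * M + 3).
have c0 : 0 < c by rewrite divr_gt0//; lra.
(* Bumps on whose support [f] varies little with [e], uniformly in [x]; a boolean, so that it can
   filter a sum. *)
pose good i := `[< \forall e \near e0, forall x, 0 < h i x ->
  `|f (x, e0) - f (x, e)| <= c >].
(* The factor [N] pushes the sum above 1 as soon as [N] exceeds both [i] and [1 / h i x] for one
   good [i] with [h i x] positive, so the truncation [H N x] tends to 1. *)
pose sumh N x : R := N%:R * \sum_(i < N | good i) h i x.
pose H N x : R := Num.min 1 (sumh N x).
have sumh0 N x : 0 <= sumh N x by rewrite mulr_ge0// sumr_ge0.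
have H0 N x : 0 <= H N x by rewrite le_min ler01 sumh0.
have H1 N x : H N x <= 1 by rewrite ge_min lexx.
have cH N : continuous (H N).
  move=> x; have c1 : {for x, continuous (fun=> 1 : R^o)} by exact: cvg_cst.
  apply: (continuous_min c1).
  apply: cvgM; first exact: cvg_cst.
  apply: cvg_big => [|i _]; [exact: add_continuous|exact: ch].
have mH N := continuous_real_measurable (cH N).
have Hbnd N x : `|H N x| <= 1 by rewrite ger0_norm.
have H_cvg x : H N x @[N --> \oo] --> (1 : R).
  have [i gi hi] : exists2 i, good i & 0 < h i x.
    (* Half of [c], since [f (y, e)] and [f (y, e0)] are both compared with [f (x, e0)]. *)
    have : nbhs (x, e0) [set p | `|f (x, e0) - f p| < c / 2].
      by move/cvgrPdist_lt : (cf (x, e0)); apply; rewrite divr_gt0.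
    move=> [[A B] [/= xA e0B] AB]; have [i hi hA] := hb x A xA.
    exists i => //; apply/asboolP; apply: (filterS _ e0B) => e Be y hy.
    have e0B' : B e0 by exact: nbhs_singleton e0B.
    have := AB (y, e) (conj (hA y hy) Be); have := AB (y, e0) (conj (hA y hy) e0B').
    by rewrite /= !ltr_norml !ler_norml; lra.
  apply: cvg_near_cst; near=> N.
  apply/min_idPl.
  have iN : (i < N)%N by near: N; exact: nbhs_infty_gt.
  rewrite /sumh (bigD1 (Ordinal iN))//= (@le_trans _ _ (N%:R * h i x))//.
    rewrite -ler_pdivrMr// div1r; near: N; exact: nbhs_infty_ger.
  by rewrite ler_wpM2l// lerDl sumr_ge0.
have intH : \int[k s0]_x H N x @[N --> \oo] --> (1 : R).
  suff : (\int[k s0]_x (H N x)%:E @[N --> \oo] --> \int[k s0]_x cst 1 x)%E.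
    by rewrite integral_cst// k1 mule1 => /fine_cvg.
  apply: (@dominated_cvg _ _ _ _ _ measurableT _ _ (cst 1%E)) => //.
  - by move=> n; apply/measurable_EFinP; exact: mH.
  - by move=> x _; apply: cvg_EFin; [exact: nearW|exact: H_cvg].
  - apply: (@bounded_integrable _ _ _ _ (k1 s0) (cst 1) 1) => // x.
    by rewrite normr1.
  - by move=> n x _; rewrite lee_fin; exact: Hbnd.
have [N HN] : exists N, 1 - c < \int[k s0]_x H N x.
  have : \forall N \near \oo, 1 - c < \int[k s0]_x H N x.
    by apply: (cvgr_gt _ intH); rewrite ltrBlDr ltrDl.
  by move=> [N _ /(_ N (leqnn N))]; exists N.
(* Only the finitely many good [i] below [N] matter. On their supports the error is at most [c]; off
   them [H N x] is 0 and the crude bound [2 * M] applies. *)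
have near_e : \forall e \near e0, forall x,
    `|f (x, e0) - f (x, e)| <= c + 2 * M * (1 - H N x).
  have : \forall e \near e0, forall i : 'I_N, good i -> forall x, 0 < h i x ->
      `|f (x, e0) - f (x, e)| <= c.
    apply: filter_forall => i; have [gi|_] := boolP (good i).
      by move/asboolP : gi; apply: filterS => e He _.
    exact: nearW.
  apply: filterS => e He x.
  have M1 : 0 <= M * (1 - H N x) by rewrite mulr_ge0// subr_ge0.
  have [[i /andP[gi hi]]|nogood] := pselect (exists i : 'I_N, good i && (0 < h i x)).
    by have := He i gi x hi; lra.
  have -> : H N x = 0.
    rewrite /H /sumh big1 ?mulr0 ?min_r// => i gi.
    apply/eqP; rewrite eq_le h0 andbT leNgt; apply/negP => hi.
    by apply: nogood; exists i; rewrite gi.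
  by have := df2 e x; lra.
have near_H : \forall s \near s0, 1 - c < \int[k s]_x H N x.
  have /(_ s0)/= HN_cvg := wk (cH N) (bounded_funW (Hbnd N)).
  exact: (cvgr_gt _ HN_cvg).
have near_f : \forall s \near s0,
    `|\int[k s0]_x f (x, e0) - \int[k s]_x f (x, e0)| < c.
  have /(_ s0)/= f_cvg := wk (cfe e0) (bounded_funW (fun x => fM (x, e0))).
  by move/cvgrPdist_lt : f_cvg; exact.
exists ([set s | 1 - c < \int[k s]_x H N x /\
    `|\int[k s0]_x f (x, e0) - \int[k s]_x f (x, e0)| < c],
   [set e | forall x, `|f (x, e0) - f (x, e)| <= c + 2 * M * (1 - H N x)]).
  by split=> //; exact: (filterI near_H near_f).
move=> [s e] /= [[sH sf] ef].
have iH : (k s).-integrable [set: borel X] (EFin \o H N).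
  exact: (@bounded_integrable _ _ _ _ (k1 s) _ 1).
have : `|\int[k s]_x f (x, e0) - \int[k s]_x f (x, e)| <=
    c + 2 * M * (1 - \int[k s]_x H N x).
  rewrite -RintegralB//.
  apply: le_trans (le_normr_Rintegral measurableT _) _.
    exact: (@bounded_integrable _ _ _ _ (k1 s) _ _ (mdf e) (df2 e)).
  have i1 : (k s).-integrable [set: borel X] (EFin \o cst (c + 2 * M)).
    exact: (@bounded_integrable _ _ _ _ (k1 s) _ `|c + 2 * M|).
  have i2 : (k s).-integrable [set: borel X] (EFin \o (fun x => 2 * M * H N x)).
    exact: (integrableZl measurableT (2 * M) iH).
  (* As [k s] has mass one, the bound is itself an integral, and it remains to compare
     integrands. *)
  rewrite [leRHS](_ : _ = \int[k s]_x (c + 2 * M - 2 * M * H N x)); last first.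
    by rewrite RintegralB// Rintegral_cst1// RintegralZl//; lra.
  apply: le_Rintegral => //.
  - apply: (@bounded_integrable _ _ _ _ (k1 s) _ (2 * M)) => [|x].
      exact: measurableT_comp (mdf e).
    by rewrite normr_id.
  - have := integrableB measurableT i1 i2; exact.
  - by move=> x _ /=; have := ef x; lra.
move: sf; rewrite ltr_norml !ler_norml => sf ef'.
have cE : c * (2 * M + 3) = eps%:num by rewrite divfK//; apply: lt0r_neq0; lra.
have : 2 * M * (1 - \int[k s]_x H N x) <= 2 * M * c.
  by rewrite ler_wpM2l ?mulr_ge0//; lra.
lra.
Unshelve. all: by end_near. Qed.

End joint_continuity.

(** * Integration against mixtures and restrictions of measures *)

Section mixtures.
Local Open Scope ereal_scope.
Context (R : realType).

HB.instance Definition _ d1 d2 d3 (A : measurableType d1)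
    (B : measurableType d2) (C : measurableType d3) (k : R.-spker B ~> C)
    (f : A -> B) (mf : measurable_fun [set: A] f) :=
  Kernel_isSubProbability.Build _ _ A C R (kpre k mf)
    ((sprob_kernelP (kpre k mf)).2 (fun x => sprob_kernel_le1 k (f x))).

Section constant_kernel.
Context d (T : measurableType d) (mu : {measure set T -> \bar R}).

(** A finite measure seen as a kernel from the one-point space, so that results on composition of
    kernels apply to it. *)
Definition kcst of mu [set: T] < +oo : unit -> {measure set T -> \bar R} :=
  fun=> mu.

Context (mu_fin : mu [set: T] < +oo).

Let measurable_kcst D : measurable D ->
  measurable_fun [set: unit] (kcst mu_fin ^~ D).
Proof. by move=> _; exact: measurable_cst. Qed.

HB.instance Definition _ :=
  isKernel.Build _ _ _ _ R (kcst mu_fin) measurable_kcst.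

Let kcst_uub : measure_fam_uub (kcst mu_fin).
Proof.
(* One is added because the uniform bound has to be strict. *)
exists (fine (mu setT) + 1)%R => x; rewrite EFinD fineK ?ge0_fin_numE//.
by rewrite lteDl ?ge0_fin_numE.
Qed.

HB.instance Definition _ :=
  Kernel_isFinite.Build _ _ _ _ R (kcst mu_fin) kcst_uub.

End constant_kernel.

(** On measurable sets [m] agrees with the composition of [l] and [k], for which integrals of
    nonnegative functions are iterated. *)
Lemma integral_mixture d1 d2 (A : measurableType d1) (B : measurableType d2)
    (l : {measure set A -> \bar R}) (k : R.-spker A ~> B)
    (m : {measure set B -> \bar R}) (f : B -> \bar R) :
  l [set: A] < +oo -> (forall D, measurable D -> m D = \int[l]_x k x D) ->
  (forall y, 0 <= f y) -> measurable_fun [set: B] f ->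
  \int[m]_y f y = \int[l]_x \int[k x]_y f y.
Proof.
move=> lfin mE f0 mf.
pose k' := kpre k (@measurable_snd _ _ unit A).
have := @integral_kcomp _ _ _ _ _ _ _ (kcst lfin) k' tt f f0 mf.
move=> <-; apply: eq_measure_integral => D mD _; exact: mE.
Qed.

(** The complement of [D] is null for the restriction, and inside [D] the two measures coincide. *)
Lemma ge0_integral_mrestr d (A : measurableType d)
    (mu : {measure set A -> \bar R}) (D : set A) (mD : measurable D)
    (f : A -> \bar R) : (forall x, 0 <= f x) -> measurable_fun [set: A] f ->
  \int[mrestr mu mD]_x f x = \int[mu]_(x in D) f x.
Proof.
move=> f0 mf; rewrite (@ge0_negligible_integral _ _ _ _ setT (~` D))//; last first.
- by rewrite /= /mrestr setICl measure0.
- exact: measurableC.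
rewrite setTD setCK; apply: eq_measure_integral => E mE ED.
by rewrite /= /mrestr; congr (mu _); exact/setIidPl.
Qed.

End mixtures.

(** * Integrals against the transition kernel of histories *)

Section history_kernel_integral.
Context (R : realType) (X Y : completeMetricType R) (U : pmetricType R).
Context (T : R.-pker (borel X * borel U)%type ~> (borel X))
  (Q : R.-pker (borel X) ~> (borel Y))
  (kappa : R.-pker (borel (hist Y U)) ~> (borel X)).

Lemma hist_kernel1 su : hist_kernel T Q kappa su [set: hist Y U] = 1%E.
Proof.
case: su => s u; rewrite hist_kernelE.
transitivity (\int[kappa s]_x 1)%E; last first.
  by rewrite integral_cst// mul1e prob_kernel.
apply: eq_integral => x _.
transitivity (\int[T (x, u)]_x' 1)%E; last first.
  by rewrite integral_cst// mul1e prob_kernel.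
apply: eq_integral => x' _; exact: prob_kernel.
Qed.

(** A change of variables along [hist_cons], then [integral_mixture] twice: over [kappa s] with [T]
    and [Q] composed, and over [T (x, u)]. *)
Lemma ge0_integral_hist_kernel (s : hist Y U) (u : U) (f : hist Y U -> \bar R) :
  (forall s', 0 <= f s')%E -> measurable_fun [set: borel (hist Y U)] f ->
  (\int[hist_kernel T Q kappa (s, u)]_s' f s' =
   \int[kappa s]_x \int[T (x, u)]_x' \int[Q x']_y f (hist_cons y u s))%E.
Proof.
move=> f0 mf; rewrite ge0_integral_pushforward//; last exact: measurable_hist_cons.
have mg := measurableT_comp mf (measurable_hist_cons u s).
have mxu : measurable_fun [set: borel X]
    (fun x : borel X => (x, u) : borel X * borel U).
  by apply: measurable_fun_pair => //; exact: measurable_cst.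
rewrite preimage_setT.
rewrite (@integral_mixture _ _ _ _ _ (kappa s) (kpre (mkcomp_noparam T Q) mxu))//.
  apply: eq_integral => x _.
  by rewrite (@integral_mixture _ _ _ _ _ (T (x, u)) Q)//= prob_kernel ltry.
- by rewrite prob_kernel ltry.
- by move=> y; exact: f0.
Qed.

End history_kernel_integral.

(** * The weak Feller property of the history kernel *)

Section weak_feller.

(** Each coordinate is either the new entry or a projection shifted by one. *)
Lemma continuous_hist_cons_joint (Y U : topologicalType) :
  continuous (fun p : Y * (hist Y U * U) =>
    hist_cons p.1 p.2.2 p.2.1 : hist Y U).
Proof.
have cf (A B : topologicalType) : continuous (@fst A B).
  by move=> p; exact: cvg_fst.
have cs (A B : topologicalType) : continuous (@snd A B).
  by move=> p; exact: cvg_snd.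
have c21 := continuousT_comp (cs Y (hist Y U * U)%type) (cf _ _).
have c1 : continuous (fun p : Y * (hist Y U * U) =>
    (hist_cons p.1 p.2.2 p.2.1).1 : {ptws nat -> Y}).
  apply: continuous_ptws => -[|n]; first exact: cf.
  exact: (continuousT_comp (continuousT_comp c21 (cf _ _))
    (@continuous_ptws_proj _ Y n)).
have c2 : continuous (fun p : Y * (hist Y U * U) =>
    (hist_cons p.1 p.2.2 p.2.1).2 : {ptws nat -> U}).
  apply: continuous_ptws => -[|n].
    exact: (continuousT_comp (cs _ _) (cs _ _)).
  exact: (continuousT_comp (continuousT_comp c21 (cs _ _))
    (@continuous_ptws_proj _ U n)).
exact: continuousT_pair.
Qed.

(** A bounded [f] becomes nonnegative after adding a constant, and under mass one this shifts the
    integral by the same constant. The reduction gives access to the iterated integral formula for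
    nonnegative functions. *)
Lemma weakly_continuous_ge0 (R : realType) (D : topologicalType)
    (T : ptopologicalType) (k : D -> {measure set (borel T) -> \bar R}) :
  (forall x, k x [set: T] = 1%E) ->
  (forall (f : T -> R) M, continuous f -> (forall y, 0 <= f y) ->
    (forall y, `|f y| <= M) -> continuous (fun x => \int[k x]_y f y)) ->
  weakly_continuous k.
Proof.
move=> k1 kcont f cf [M [_ /(_ (M + 1)) fM]].
have {}fM y : `|f y| <= M + 1 by apply: fM => //; rewrite ltrDl.
have cfM : continuous (fun y => f y + (M + 1)).
  by move=> y; apply: cvgD; [exact: cf|exact: cvg_cst].
rewrite (_ : (fun x => _) = (fun x => \int[k x]_y (f y + (M + 1)) - (M + 1))).
  move=> x; apply: cvgB; last exact: cvg_cst.
  apply: (kcont _ (M + 1 + `|M + 1|) cfM) => y.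
    by have := fM y; rewrite ler_norml; lra.
  by rewrite (le_trans (ler_normD _ _))// lerD2r.
apply/funext => x; rewrite RintegralD//.
- by rewrite Rintegral_cst1// addrK.
- exact: (bounded_integrable (k1 x) (continuous_real_measurable cf) fM).
- exact: (@bounded_integrable _ _ _ _ (k1 x) (cst (M + 1)) `|M + 1|).
Qed.

Context (R : realType) (X Y : completeMetricType R) (U : pmetricType R).
Context (T : R.-pker (borel X * borel U)%type ~> (borel X))
  (Q : R.-pker (borel X) ~> (borel Y))
  (kappa : R.-pker (borel (hist Y U)) ~> (borel X)).
Context (sepX : separable X) (sepY : separable Y)
  (wQ : @weakly_continuous R X Y Q)
  (wT : @weakly_continuous R (X * U)%type X T)
  (wkappa : @weakly_continuous R (hist Y U) X kappa).

Let nonneg_continuous (f : hist Y U -> R) (M : R) : continuous f ->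
  (forall s, 0 <= f s) -> (forall s, `|f s| <= M) ->
  continuous (fun su : hist Y U * U => \int[hist_kernel T Q kappa su]_s f s).
Proof.
move=> cf f0 fM.
(* [phi] averages over the next observation and [psi] over the next state. The kernel argument and
   the pair (history, action) are kept as separate variables, as [weakly_continuous_joint]
   requires. *)
pose phi (p : X * (hist Y U * U)) : R :=
  \int[Q p.1]_y f (hist_cons y p.2.2 p.2.1).
pose psi (p : (X * U) * (hist Y U * U)) : R :=
  \int[T p.1]_x' phi (x', p.2).
have Q1 x : Q x [set: Y] = 1%E by exact: prob_kernel.
have T1 xu : T xu [set: X] = 1%E by exact: prob_kernel.
have k1 s : kappa s [set: X] = 1%E by exact: prob_kernel.
have cfc : continuous (fun p : Y * (hist Y U * U) => f (hist_cons p.1 p.2.2 p.2.1)).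
  exact: (continuousT_comp (@continuous_hist_cons_joint Y U) cf).
have mfc u s : measurable_fun [set: borel Y] (fun y => f (hist_cons y u s)).
  apply: continuous_real_measurable.
  exact: (continuousT_comp (@continuous_hist_cons Y U u s) cf).
have cphi : continuous phi.
  exact: (weakly_continuous_joint Q1 sepY wQ cfc (fun p => fM _)).
have phiM p : `|phi p| <= M by exact: (Rintegral_bound (Q1 _) (mfc _ _)).
have mphi su : measurable_fun [set: borel X] (fun x => phi (x, su)).
  have csu := @continuous_sectionl _ _ _ _ su cphi.
  exact: (continuous_real_measurable csu).
have cpsi : continuous psi.
  exact: (weakly_continuous_joint T1 sepX wT cphi phiM).
have psiM p : `|psi p| <= M by exact: (Rintegral_bound (T1 _) (mphi _)).
have cpsi' : continuous (fun p : X * (hist Y U * U) => psi ((p.1, p.2.2), p.2)).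
  apply: (@continuousT_comp _ _ _
    (fun p : X * (hist Y U * U) => ((p.1, p.2.2), p.2)) psi _ cpsi).
  have cs : continuous (fun p : X * (hist Y U * U) => p.2).
    by move=> p; exact: cvg_snd.
  apply: continuousT_pair => //; apply: continuousT_pair.
    by move=> p; exact: cvg_fst.
  by apply: (continuousT_comp cs) => p; exact: cvg_snd.
have cchi := weakly_continuous_joint k1 sepX wkappa cpsi' (fun p => psiM _).
rewrite (_ : (fun su => _) =
    (fun su => \int[kappa su.1]_x psi ((x, su.2), su))); last first.
  apply/funext => -[s u]; rewrite /Rintegral ge0_integral_hist_kernel//; last first.
    by apply/measurable_EFinP; exact: continuous_real_measurable.
  congr fine; apply: eq_integral => x _.
  transitivity (\int[T (x, u)]_x' (phi (x', (s, u)))%:E)%E; last first.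
    rewrite /psi /Rintegral fineK//; apply: integrable_fin_num => //.
    exact: (bounded_integrable (T1 _) (mphi _)).
  apply: eq_integral => x' _; rewrite /phi /Rintegral fineK//.
  apply: integrable_fin_num => //.
  exact: (bounded_integrable (Q1 _) (mfc _ _)).
(* The history in the kernel and the one in the parameter are now identified, by composing with a
   continuous diagonal map. *)
apply: (@continuousT_comp _ _ _
  (fun su : hist Y U * U => (su.1, su)) _ _ cchi).
by apply: continuousT_pair => su; [exact: cvg_fst|exact: cvg_id].
Qed.

Theorem weakly_continuous_hist_kernel :
  @weakly_continuous R (hist Y U * U)%type (hist Y U) (hist_kernel T Q kappa).
Proof.
exact: (weakly_continuous_ge0 (hist_kernel1 T Q kappa) nonneg_continuous).
Qed.

End weak_feller.

(** * Conditional expectations given a random variable *)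

Section conditioning_on_a_variable.
Context (R : realType) d dX dT (Om : measurableType d) (X : measurableType dX)
  (T : measurableType dT) (P : probability Om R) (Z : Om -> X) (S : Om -> T).
Context (mZ : measurable_fun [set: Om] Z) (mS : measurable_fun [set: Om] S).

Lemma sigma_of_measurable H : sigma_of S H -> measurable H.
Proof. by move=> [B mB <-]; exact: mS. Qed.

Lemma measurable_wrt_comp (phi : T -> R) : measurable_fun [set: T] phi ->
  measurable_wrt (sigma_of S) (phi \o S).
Proof.
move=> mphi _ [B mB <-]; exists (phi @^-1` B); last by rewrite !setTI.
by rewrite -[X in measurable X]setTI; exact: mphi.
Qed.

(** [phi] and [psi] have equal integrals over every measurable set under the law of [S], hence agree
    almost everywhere for that law; the null set is pulled back along [S]. *)
Lemma is_cond_exp_unique (phi psi : T -> R) (f : Om -> R) :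
  measurable_fun [set: T] phi -> measurable_fun [set: T] psi ->
  is_cond_exp P (sigma_of S) f (phi \o S) ->
  is_cond_exp P (sigma_of S) f (psi \o S) ->
  {ae P, forall w, phi (S w) = psi (S w)}.
Proof.
(* The averaging identity is given for the version [E'] only; integrability and integrals pass to
   [g \o S] by a.e. equality. *)
have cond_expE g : measurable_fun [set: T] g ->
    is_cond_exp P (sigma_of S) f (g \o S) ->
    P.-integrable [set: Om] (EFin \o (g \o S)) /\
    forall B, measurable B -> (\int[P]_(w in S @^-1` B) (g (S w))%:E =
                              \int[P]_(w in S @^-1` B) (f w)%:E)%E.
  move=> mg [_ [E' [_ iE' E'f aeE]]].
  have mgS : measurable_fun [set: Om] (EFin \o (g \o S)).
    by apply/measurable_EFinP; exact: measurableT_comp mg mS.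
  have mE' := measurable_int _ iE'.
  split.
    apply/integrableP; split => //; case/integrableP : iE' => _.
    apply: le_lt_trans; rewrite le_eqVlt; apply/orP; left; apply/eqP.
    apply: ae_eq_integral => //; [exact: measurableT_comp|exact: measurableT_comp|].
    by apply: filterS aeE => w /= ->.
  move=> B mB; have sB : sigma_of S (S @^-1` B) by exists B; rewrite ?setTI.
  have mSB := sigma_of_measurable sB.
  rewrite -(E'f _ sB); apply: ae_eq_integral => //.
  - exact: measurable_funTS mgS.
  - exact: measurable_funTS mE'.
  - by apply: filterS aeE => w /= ->.
move=> mphi mpsi /(cond_expE _ mphi)[iphi phiE] /(cond_expE _ mpsi)[ipsi psiE].
pose S' : {mfun Om >-> T} := HB.pack S (isMeasurableFun.Build _ _ _ _ S mS).
have intS B g : measurable B -> P.-integrable [set: Om] (EFin \o (g \o S)) ->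
    P.-integrable (S' @^-1` B) ((EFin \o g) \o S').
  move=> mB; apply: integrableS => //.
  by rewrite -[X in measurable X]setTI; exact: mS.
have : ae_eq (distribution P S') setT (EFin \o phi) (EFin \o psi).
  apply: integral_ae_eq => //.
  - apply: (@integrable_pushforward _ _ _ _ _ S mS) => //.
    exact/measurable_EFinP.
  - exact/measurable_EFinP.
  - move=> B _ mB.
    rewrite (@integral_pushforward _ _ _ _ _ S mS P B (EFin \o phi))//; last 2 first.
    + exact/measurable_EFinP.
    + exact: intS.
    rewrite (@integral_pushforward _ _ _ _ _ S mS P B (EFin \o psi))//; last 2 first.
    + exact/measurable_EFinP.
    + exact: intS.
    by rewrite /comp/= phiE// psiE.
move=> [N [mN N0 Nsub]].
exists (S @^-1` N); split => //.
  by rewrite -[X in measurable X]setTI; exact: mS.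
move=> w /= ne; apply: Nsub => /= e; apply: ne.
by have [] := e Logic.I.
Qed.

Context (kappa : R.-pker T ~> X).
Context (kappaP : forall A, measurable A -> is_cond_exp P (sigma_of S)
  (\1_(Z @^-1` A)) (fun w => fine (kappa (S w) A))).

Lemma cond_kernel_mixture H A : sigma_of S H -> measurable A ->
  P (H `&` Z @^-1` A) = (\int[P]_(w in H) kappa (S w) A)%E.
Proof.
move=> sH mA; have mH := sigma_of_measurable sH.
have [_ [E' [_ iE' E'H aeE]]] := kappaP mA.
have mZA : measurable (Z @^-1` A).
  by rewrite -[X in measurable X]setTI; exact: mZ.
rewrite setIC -integral_indic// -(E'H _ sH).
apply: ae_eq_integral => //.
- exact: measurable_funTS (measurable_int _ iE').
- apply: measurable_funTS.
  exact: (measurableT_comp (measurable_kernel kappa A mA) mS).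
apply: filterS aeE => w /= <- _; rewrite fineK//.
rewrite ge0_fin_numE//; apply: (@le_lt_trans _ _ (kappa (S w) setT)).
  by apply: le_measure; rewrite ?inE.
by rewrite prob_kernel ltry.
Qed.

Lemma cond_exp_kernel (h : X -> R) (M : R) : measurable_fun [set: X] h ->
  (forall x, 0 <= h x) -> (forall x, `|h x| <= M) ->
  is_cond_exp P (sigma_of S) (h \o Z) (fun w => \int[kappa (S w)]_x h x).
Proof.
move=> mh h0 hM.
have P1 : P [set: Om] = 1%E by exact: probability_setT.
have k1 s : kappa s [set: X] = 1%E by exact: prob_kernel.
have mhE : measurable_fun [set: X] (EFin \o h) by exact/measurable_EFinP.
have mhZ := measurableT_comp mh mZ.
have mphiE : measurable_fun [set: T] (fun s => \int[kappa s]_x (h x)%:E)%E.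
  apply: (@measurable_fun_integral_kernel _ _ _ _ _ kappa) => // D mD.
  exact: measurable_kernel.
have mphi : measurable_fun [set: T] (fun s => \int[kappa s]_x h x).
  exact: measurableT_comp mphiE.
have mphiS := measurableT_comp mphi mS.
have phiM s : `|\int[kappa s]_x h x| <= M by exact: (Rintegral_bound (k1 s)).
split; first exact: (bounded_integrable P1 mhZ (fun w => hM _)).
exists (fun w => \int[kappa (S w)]_x h x); split.
- exact: measurable_wrt_comp mphi.
- exact: (bounded_integrable P1 mphiS (fun w => phiM _)).
- move=> H sH; have mH := sigma_of_measurable sH.
  rewrite -(@ge0_integral_mrestr _ _ _ P H mH (fun w => (h (Z w))%:E))//; last 2 first.
  - by move=> w; rewrite lee_fin.
  - exact/measurable_EFinP.
  transitivity (\int[pushforward (mrestr P mH) Z]_x (h x)%:E)%E; last first.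
    by rewrite ge0_integral_pushforward// => x _; rewrite lee_fin.
  (* [kpre kappa mS] sends [w] to [kappa (S w)], so the mixing measure is [P] restricted to [H], on
     [Om] itself. *)
  rewrite (@integral_mixture _ _ _ _ _ (mrestr P mH) (kpre kappa mS))//.
  - rewrite ge0_integral_mrestr//.
    + apply: eq_integral => w _; rewrite /Rintegral fineK//.
      exact: (integrable_fin_num measurableT (bounded_integrable (k1 _) mh hM)).
    + by move=> w; apply: integral_ge0 => x _; rewrite lee_fin.
    + exact: (measurableT_comp mphiE mS).
  - apply: (@le_lt_trans _ _ (P setT)); last by rewrite P1 ltry.
    by rewrite /= /mrestr setTI le_measure ?inE.
  - move=> D mD; rewrite ge0_integral_mrestr//.
    + by rewrite -cond_kernel_mixture// setIC.
    + exact: (measurableT_comp (measurable_kernel kappa D mD) mS).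
- exact: aeW.
Qed.

End conditioning_on_a_variable.

(** * Measurability of the history *)

Section conditional_cost.
Context (R : realType) (X Y : completeMetricType R) (U : pmetricType R).
Context (dO dW dV : measure_display) (Om : measurableType dO)
  (W : measurableType dW) (V : measurableType dV).
Implicit Types (p : process R Om X Y U W V).

(** Countable bases, from separability of [Y] and compactness of [U], reduce Borel measurability of
    the whole history to that of its entries. *)
Lemma measurable_histS p t : separable Y -> compact [set: U] ->
  (forall r, measurable_fun [set: Om] (obY p r : Om -> borel Y)) ->
  (forall r, measurable_fun [set: Om] (acU p r : Om -> borel U)) ->
  measurable_fun [set: Om] (histS p t : Om -> borel (hist Y U)).
Proof.
move=> sepY cptU mY mU.
have [h [_ _ hb]] := separable_bump_base sepY.
have [b bb] := second_countable_base (compact_second_countable cptU).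
apply: (measurable_pair_borel (ptws_base nat hb)).
  exact: (measurable_ptws_borel hb).
exact: (measurable_ptws_borel bb).
Qed.

End conditional_cost.

(** * The expected cost given the history *)

Section expected_cost_theory.
Context (R : realType) (X Y : completeMetricType R) (U : pmetricType R).
Context (c : X * U -> R) (M : R) (c_cont : continuous c)
  (c_ge0 : forall xu, 0 <= c xu) (cM : forall xu, `|c xu| <= M)
  (sepX : separable X).
Context (kappa : R.-pker (borel (hist Y U)) ~> (borel X)).

Let measurable_cost u : measurable_fun [set: borel X] (fun x => c (x, u)).
Proof.
have cu := @continuous_sectionl _ _ _ _ u c_cont.
exact: (continuous_real_measurable cu).
Qed.

Let kappa1 s : kappa s [set: X] = 1%E. Proof. exact: prob_kernel. Qed.

(** A countable base of [X] makes the continuous [c] measurable for the product of the Borel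
    sigma-algebras; integrating out the state then keeps joint measurability in history and
    action. *)
Lemma measurable_expected_cost :
  measurable_fun [set: borel (hist Y U) * borel U]
    (expected_cost c kappa : borel (hist Y U) * borel U -> R).
Proof.
have [h [_ _ hb]] := separable_bump_base sepX.
have mc : measurable_fun [set: borel X * borel U] (c : borel X * borel U -> R).
  exact: (continuous_prod_measurable hb c_cont).
pose k := kpre kappa (@measurable_fst _ _ (borel (hist Y U)) (borel U)).
have := @measurable_fun_integral_finite_kernel _ _ _ _ _
  (fun p : (borel (hist Y U) * borel U) * borel X => (c (p.2, p.1.2))%:E) k.
move=> mint; apply: (measurableT_comp (fine_measurable measurableT)).
apply: mint => [p|]; first by rewrite lee_fin.
apply/measurable_EFinP; apply: (measurableT_comp mc).
apply: measurable_fun_pair; first exact: measurable_snd.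
exact: (measurableT_comp measurable_snd measurable_fst).
Qed.

Lemma expected_cost_bound su : `|expected_cost c kappa su| <= M.
Proof. exact: (Rintegral_bound (kappa1 _) (measurable_cost _)). Qed.

Lemma continuous_expected_cost :
  @weakly_continuous R (hist Y U) X kappa -> continuous (expected_cost c kappa).
Proof. by move=> wk; exact: (weakly_continuous_joint kappa1 sepX wk c_cont cM). Qed.

Context (dO dW dV : measure_display) (Om : measurableType dO)
  (W : measurableType dW) (V : measurableType dV) (p : process R Om X Y U W V).

Lemma expected_cost_cond_exp :
  (forall t, measurable_fun [set: Om] (stX p t : Om -> borel X)) ->
  (forall t, measurable_fun [set: Om] (histS p t : Om -> borel (hist Y U))) ->
  is_state_kernel p kappa -> is_expected_cost c p (expected_cost c kappa).
Proof.
move=> mX mS kappaP u t.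
exact: (cond_exp_kernel (mX t) (mS t) (kappaP t) (measurable_cost u)
  (fun x => c_ge0 _) (fun x => cM _)).
Qed.

(** With [u] frozen, both sections are versions of one conditional expectation; the exceptional null
    set may depend on [t] and [u]. *)
Lemma is_expected_cost_unique (f1 f2 : hist Y U * U -> R) :
  (forall t, measurable_fun [set: Om] (histS p t : Om -> borel (hist Y U))) ->
  measurable_fun [set: borel (hist Y U) * borel U]
    (f1 : borel (hist Y U) * borel U -> R) ->
  measurable_fun [set: borel (hist Y U) * borel U]
    (f2 : borel (hist Y U) * borel U -> R) ->
  is_expected_cost c p f1 -> is_expected_cost c p f2 ->
  forall (t : int) (u : U),
    {ae law p, forall w, f1 (histS p t w, u) = f2 (histS p t w, u)}.
Proof.
move=> mS mf1 mf2 f1P f2P t u.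
have mpair : measurable_fun [set: borel (hist Y U)]
    (fun s : borel (hist Y U) => (s, u) : borel (hist Y U) * borel U).
  by apply: measurable_fun_pair => //; exact: measurable_cst.
exact: (is_cond_exp_unique (mS t) (measurableT_comp mf1 mpair)
  (measurableT_comp mf2 mpair) (f1P u t) (f2P u t)).
Qed.

End expected_cost_theory.

(** * From the filter to a kernel on histories *)

Section filter_kernel.
Context (R : realType) (X Y : completeMetricType R) (U : pmetricType R).
Context (dO dW dV : measure_display) (Om : measurableType dO)
  (W : measurableType dW) (V : measurableType dV) (p : process R Om X Y U W V).

(** Tower property: the filter conditions on a sigma-algebra containing that of [S_t], and being
    almost surely a function of [S_t] it is also the conditional law given [S_t] alone. *)
Lemma filter_state_kernel (pi : int -> Om -> pprobability (borel X) R)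
    (g : borel (hist Y U) -> pprobability (borel X) R)
    (mg : measurable_fun [set: borel (hist Y U)] g) :
  (forall t, measurable_fun [set: Om] (histS p t : Om -> borel (hist Y U))) ->
  is_filter p pi ->
  (forall t (A : set (borel X)), measurable A ->
     {ae law p, forall w, g (histS p t w) A = pi t w A}) ->
  is_state_kernel p (kprobability mg).
Proof.
move=> mS [_ piP] gpi t A mA.
(* The choice [n = |t|] ensures [- n <= t], as [is_filter] demands. *)
have [int1 [E' [_ iE' E'A aeE]]] := piP t `|t|%N A (ltac:(lia)) mA.
have mgA : measurable_fun [set: borel (hist Y U)]
    (fun s : borel (hist Y U) => fine (g s A)).
  apply: (measurableT_comp (fine_measurable measurableT)).
  exact: (measurable_kernel (kprobability mg) A mA).
have mgS := measurableT_comp mgA (mS t).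
split => //; exists (fun w => fine (g (histS p t w) A)); split.
- exact: (measurable_wrt_comp mgA).
- apply: (bounded_integrable (probability_setT _) mgS (M := 1)) => w.
  rewrite ger0_norm ?fine_ge0// -lee_fin fineK ?probability_le1//.
  exact: fin_num_measure.
- move=> H sH; have mH := sigma_of_measurable (mS t) sH.
  rewrite -E'A; last by apply: sub_gen_smallest; left.
  apply: ae_eq_integral => //.
  + exact/measurable_funTS/measurable_EFinP.
  + exact: measurable_funTS (measurable_int _ iE').
  + by apply: filterS2 aeE (gpi t A mA) => w /= <- -> _.
- exact: aeW.
Qed.

End filter_kernel.

(** * Assembly of (i), (ii) and (iii) *)

Theorem theorem7 (R : realType)
  (X Y : completeMetricType R) (U : pmetricType R)
  (sepX : separable X) (sepY : separable Y) (cptU : compact [set: U])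
  (dO dW dV : measure_display) (Om : measurableType dO)
  (W : measurableType dW) (V : measurableType dV)
  (F : X * U * W -> X)
  (mF : measurable_fun [set: borel X * borel U * W]
          (F : borel X * borel U * W -> borel X))
  (G : X * V -> Y)
  (mG : measurable_fun [set: borel X * V] (G : borel X * V -> borel Y))
  (muW : probability W R) (muV : probability V R)
  (T : R.-pker (borel X * borel U)%type ~> (borel X))
  (TE : forall (x : X) (u : U) (B : set (borel X)), measurable B ->
          T (x, u) B = muW [set w | B (F (x, u, w))])
  (Q : R.-pker (borel X) ~> (borel Y))
  (QE : forall (x : X) (C : set (borel Y)), measurable C ->
          Q x C = muV [set v | C (G (x, v))])
  (c : X * U -> R) (c_ge0 : forall xu, 0 <= c xu)
  (c_cont : continuous c) (c_bnd : bounded_fun c)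
  (I : Type) (gam : I -> policy Y U) (sys : I -> process R Om X Y U W V)
  (sysP : forall i, controlled F G muW muV (gam i) (sys i)) :
  (* (i) *)
  (forall pi : I -> int -> Om -> pprobability (borel X) R,
     (forall i, is_filter (sys i) (pi i)) ->
     filter_measurable sys pi ->
     exists cbar : hist Y U * U -> R,
       measurable_fun [set: borel (hist Y U) * borel U]
         (cbar : borel (hist Y U) * borel U -> R) /\
       forall i, is_expected_cost c (sys i) cbar) /\
  (forall kappa : R.-pker (borel (hist Y U)) ~> (borel X),
     (forall i, is_state_kernel (sys i) kappa) ->
     @weakly_continuous R (hist Y U) X kappa ->
     (* (ii) *)
     ([/\ continuous (expected_cost c kappa),
          bounded_fun (expected_cost c kappa),
          measurable_fun [set: borel (hist Y U) * borel U]
            (expected_cost c kappa : borel (hist Y U) * borel U -> R),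
          forall i, is_expected_cost c (sys i) (expected_cost c kappa) &
          forall cbar : hist Y U * U -> R,
            measurable_fun [set: borel (hist Y U) * borel U]
              (cbar : borel (hist Y U) * borel U -> R) ->
            (forall i, is_expected_cost c (sys i) cbar) ->
            forall i (k : int) (u : U),
              {ae law (sys i), forall w,
                 cbar (histS (sys i) k w, u) =
                 expected_cost c kappa (histS (sys i) k w, u)}]) /\
     (* (iii) *)
     (@weakly_continuous R X Y Q ->
      @weakly_continuous R (X * U)%type X T ->
      @weakly_continuous R (hist Y U * U)%type (hist Y U)
        (hist_kernel T Q kappa))).
Proof.
(* [bounded_fun] yields bounds only by numbers strictly above [M], hence [M + 1]. *)
have [M [_ /(_ (M + 1)) cM]] := c_bnd.
have {}cM xu : `|c xu| <= M + 1 by apply: cM => //; rewrite ltrDl.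
have mX i t : measurable_fun [set: Om] (stX (sys i) t : Om -> borel X).
  by have [[mX _ _ _ _] _ _ _] := sysP i.
have mS i t : measurable_fun [set: Om] (histS (sys i) t : Om -> borel (hist Y U)).
  by have [[_ mY mU _ _] _ _ _] := sysP i; exact: measurable_histS.
have ec_cond_exp kappa i : is_state_kernel (sys i) kappa ->
    is_expected_cost c (sys i) (expected_cost c kappa).
  exact: (expected_cost_cond_exp c_cont c_ge0 cM (mX i) (mS i)).
split=> [pi piP [_ [g mg gpi]]|kappa kappaP wkappa].
  (* Since [g] is common to all policies and times, so is the cost integrated against it. *)
  exists (expected_cost c (kprobability mg)); split.
    exact: measurable_expected_cost.
  move=> i; apply: ec_cond_exp.
  exact: (filter_state_kernel mg (mS i) (piP i) (gpi i)).
have mec : measurable_fun [set: borel (hist Y U) * borel U]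
    (expected_cost c kappa : borel (hist Y U) * borel U -> R).
  exact: measurable_expected_cost.
split; last by move=> wQ wT; exact: weakly_continuous_hist_kernel.
split=> //.
- exact: (continuous_expected_cost c_cont cM).
- exact: (bounded_funW (expected_cost_bound c_cont cM kappa)).
- by move=> i; exact: ec_cond_exp.
move=> cbar mcbar cbarP i k u.
exact: (is_expected_cost_unique (mS i) mcbar mec (cbarP i)
  (ec_cond_exp _ _ (kappaP i)) k u).
Qed.
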